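(* Let $k\ge 1$ be an integer. For all real numbers $x_1,\dots,x_{k+1},t$, the equation $$\langle x_1+x_2+\cdots+x_{k+1}+t\rangle=\sum_{S\subsetneq\{1,\dots,k+1\}}(-1)^{k-|S|}\Big\langle \sum_{m\in S}x_m+t\Big\rangle$$ is true in the geometric sense. That is, for every placement of the initial simplex $\langle t\rangle$, the integer-valued function on $\mathbb{R}^k$ represented by the left-hand side equals, at every point of $\mathbb{R}^k$, the signed sum of the functions represented by the terms on the right-hand side.
   Context: Fix a closed non-degenerate $k$-dimensional simplex in $\mathbb{R}^k$ (not necessarily regular), with its $k+1$ facets ordered; it and all its translates are denoted $\langle 1\rangle$. Let $\beta_1,\dots,\beta_{k+1}$ be its barycentric coordinates, so that each $\beta_i:\mathbb{R}^k\to\mathbb{R}$ is affine, $\sum_i\beta_i=1$, the simplex is $\{\beta_i\ge0\ \forall i\}$, and its $i$-th facet lies in the hyperplane $\beta_i=0$. Write $\beta_i=c_i-\ell_i$ with $\ell_i$ linear and $c_i\in\mathbb{R}$. Then $\sum_i\ell_i=0$, $\sum_ic_i=1$, and $\langle1\rangle=\{p:\ell_i(p)\le c_i\ \forall i\}$. Placed elements. For $(s_1,\dots,s_{k+1})\in\mathbb{R}^{k+1}$ put $s=\sum_is_i$. The hyperplanes $\ell_i=s_i$ determine a placed copy of the element $\langle s\rangle$, as follows. - If $s>0$, it is the closed simplex $\{p:\ell_i(p)\le s_i\ \forall i\}$ (a homothetic image of $\langle1\rangle$ with ratio $s$), counted with multiplicity $+1$. - If $s=0$, it is the single point $\{p:\ell_i(p)=s_i\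 \forall i\}$, counted with multiplicity $+1$. - If $s<0$, it is the open simplex $\{p:\ell_i(p)>s_i\ \forall i\}$ (oppositely oriented to $\langle1\rangle$), counted with multiplicity $(-1)^k$. Each placed element is thus represented by an integer-valued function on $\mathbb{R}^k$, namely its multiplicity times the indicator function of the corresponding set. The element $-\langle s\rangle$ in the same position is represented by the negative of that function; thus $\langle s\rangle$ and $-\langle s\rangle$ laid on each other cancel to the empty set. The terms of the equation. A placement of the initial element $\langle t\rangle$ is a choice of $(t_1,\dots,t_{k+1})\in\mathbb{R}^{k+1}$ with $\sum_it_i=t$. With this placement fixed, for $S\subseteq\{1,\dots,k+1\}$ the term $\langle\sum_{m\in S}x_m+t\rangle$ denotes the placed element determined by $(s_1,\dots,s_{k+1})$, where $s_i=t_i+x_i$ if $i\in S$ and $s_i=t_i$ if $i\notin S$. In other words, for each $i\in S$ the $i$-th facet hyperplane is moved by $x_i$, outward if $x_i>0$ and inward if $x_i<0$. The left-hand side is the term with $S=\{1,\dots,k+1\}$, and $S=\emptyset$ gives $\langle t\rangle$. The same placement is used for all terms. An equation $\langle x\rangle=\sum_j\alpha_j\langle x_j\rangle$ with $\alpha_j\in\{-1,1\}$ is true in the geometric sense if the simplex $\langle x\rangle$ can be built from the placed elements $\alpha_j\langle x_j\rangle$ by superposition with cancellation, i.e. if the corresponding functions are equal. *)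

(* Defs.v *)
From HB Require Import structures.
From mathcomp Require Import all_boot all_order all_algebra.
From mathcomp Require Import classical_sets reals numfun.
Set Implicit Arguments.
Unset Strict Implicit.
Unset Printing Implicit Defensive.
Import Order.TTheory GRing.Theory Num.Theory.
Local Open Scope classical_set_scope.
Local Open Scope ring_scope.

(* A non-degenerate k-simplex with ordered facets is given by its k+1 affinely
   independent vertices; the i-th facet is the one opposite to vertex i. *)
Definition affinely_independent (R : realType) (k : nat)
    (v : 'I_k.+1 -> 'rV[R]_k) : Prop :=
  forall a : 'I_k.+1 -> R,
    \sum_i a i = 0 -> \sum_i a i *: v i = 0 -> forall i, a i = 0.

Definition simplex (R : realType) (k : nat) (v : 'I_k.+1 -> 'rV[R]_k) :
    set 'rV[R]_k :=
  [set p | exists a : 'I_k.+1 -> R,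
     [/\ forall i, 0 <= a i, \sum_i a i = 1 & p = \sum_i a i *: v i]].

Definition vertex_mx (R : realType) (k : nat) (v : 'I_k.+1 -> 'rV[R]_k) :
    'M[R]_(1 + k) :=
  \matrix_i row_mx 1%:M (v i).

(* The barycentric coordinates (b_i) of p solve b *m vertex_mx v = (1, p), that
   is, \sum_i b_i = 1 and \sum_i b_i *: v i = p; see sum_bary, baryK and
   bary_unique. *)
Definition bary (R : realType) (k : nat) (v : 'I_k.+1 -> 'rV[R]_k)
    (i : 'I_k.+1) (p : 'rV[R]_k) : R :=
  (row_mx 1%:M p *m invmx (vertex_mx v)) 0 i.

(* bary v i p = bary_cst v i - ell v i p, with ell v i linear. *)
Definition bary_cst (R : realType) (k : nat) (v : 'I_k.+1 -> 'rV[R]_k)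
    (i : 'I_k.+1) : R := bary v i 0.

Definition ell (R : realType) (k : nat) (v : 'I_k.+1 -> 'rV[R]_k)
    (i : 'I_k.+1) (p : 'rV[R]_k) : R := bary_cst v i - bary v i p.

Definition placed (R : realType) (k : nat) (v : 'I_k.+1 -> 'rV[R]_k)
    (s : 'I_k.+1 -> R) : 'rV[R]_k -> int :=
  if 0 < \sum_i s i then \1_[set p | forall i, ell v i p <= s i]
  else if \sum_i s i == 0 then \1_[set p | forall i, ell v i p = s i]
  else fun p => (-1) ^+ k * \1_[set q | forall i, s i < ell v i q] p.

Definition move_facets (R : realType) (k : nat) (t x : 'I_k.+1 -> R)
    (S : {set 'I_k.+1}) : 'I_k.+1 -> R :=
  fun i => if i \in S then t i + x i else t i.

Lemma mul_vertex_mx (R : realType) (k : nat) (v : 'I_k.+1 -> 'rV[R]_k)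
    (a : 'rV[R]_(1 + k)) :
  a *m vertex_mx v = row_mx (\sum_i a 0 i)%:M (\sum_i a 0 i *: v i).
Proof.
rewrite mulmx_sum_row.
under eq_bigr do rewrite rowK scale_row_mx.
apply/rowP => j; rewrite summxE -(splitK j).
case: (split j) => l /=.
  rewrite row_mxEl mxE ord1 eqxx mulr1n; apply: eq_bigr => i _.
  by rewrite row_mxEl !mxE eqxx mulr1.
by rewrite row_mxEr summxE; apply: eq_bigr => i _; rewrite row_mxEr.
Qed.

Lemma vertex_mx_unit (R : realType) (k : nat) (v : 'I_k.+1 -> 'rV[R]_k) :
  affinely_independent v -> vertex_mx v \in unitmx.
Proof.
move=> v_indep; rewrite -row_free_unit -kermx_eq0; apply/rowV0P => a.
move/sub_kermxP; rewrite mul_vertex_mx -[RHS]row_mx0 => /eq_row_mx[a0 av0].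
apply/rowP => i; rewrite mxE; apply: (v_indep (fun i => a 0 i)) => //.
by have /matrixP/(_ 0 0) := a0; rewrite !mxE.
Qed.

Lemma bary_mx (R : realType) (k : nat) (v : 'I_k.+1 -> 'rV[R]_k) (p : 'rV[R]_k) :
  affinely_independent v ->
  (\sum_i bary v i p)%:M = 1%:M :> 'M_1 /\ \sum_i bary v i p *: v i = p.
Proof.
move=> v_indep; apply: eq_row_mx; rewrite -mul_vertex_mx.
by rewrite mulmxKV // vertex_mx_unit.
Qed.

Lemma sum_bary (R : realType) (k : nat) (v : 'I_k.+1 -> 'rV[R]_k) (p : 'rV[R]_k) :
  affinely_independent v -> \sum_i bary v i p = 1.
Proof. by move=> /(bary_mx p)[/matrixP/(_ 0 0)]; rewrite !mxE. Qed.

Lemma baryK (R : realType) (k : nat) (v : 'I_k.+1 -> 'rV[R]_k) (p : 'rV[R]_k) :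
  affinely_independent v -> \sum_i bary v i p *: v i = p.
Proof. by move=> /(bary_mx p)[]. Qed.

Lemma bary_unique (R : realType) (k : nat) (v : 'I_k.+1 -> 'rV[R]_k)
    (a : 'I_k.+1 -> R) :
  affinely_independent v -> \sum_i a i = 1 ->
  forall i, bary v i (\sum_j a j *: v j) = a i.
Proof.
move=> v_indep a1 i; apply/eqP; rewrite -subr_eq0; apply/eqP.
apply: (v_indep (fun i => bary v i (\sum_j a j *: v j) - a i)).
  by rewrite sumrB sum_bary // a1 subrr.
under eq_bigr do rewrite scalerBl.
by rewrite sumrB baryK // subrr.
Qed.

Lemma ellE (R : realType) (k : nat) (v : 'I_k.+1 -> 'rV[R]_k) (i : 'I_k.+1)
    (p : 'rV[R]_k) :
  ell v i p = - (row_mx 0 p *m invmx (vertex_mx v)) 0 i.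
Proof.
rewrite /ell /bary_cst /bary -[LHS]opprB; congr (- _).
rewrite -[row_mx 0 p](_ : row_mx 1%:M p - row_mx 1%:M 0 = _).
  by rewrite mulmxBl !mxE.
by rewrite opp_row_mx add_row_mx subrr subr0.
Qed.

Lemma ell_linear (R : realType) (k : nat) (v : 'I_k.+1 -> 'rV[R]_k)
    (i : 'I_k.+1) (a : R) (p q : 'rV[R]_k) :
  ell v i (a *: p + q) = a * ell v i p + ell v i q.
Proof.
rewrite !ellE -[row_mx 0 (_ + _)](_ : a *: row_mx 0 p + row_mx 0 q = _).
  by rewrite mulmxDl -scalemxAl !mxE opprD mulrN.
by rewrite scale_row_mx add_row_mx scaler0 addr0.
Qed.

Lemma sum_ell (R : realType) (k : nat) (v : 'I_k.+1 -> 'rV[R]_k) (p : 'rV[R]_k) :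
  affinely_independent v -> \sum_i ell v i p = 0.
Proof. by move=> v_indep; rewrite sumrB !sum_bary // subrr. Qed.

Lemma simplexE (R : realType) (k : nat) (v : 'I_k.+1 -> 'rV[R]_k) :
  affinely_independent v ->
  simplex v = [set p | forall i, ell v i p <= bary_cst v i].
Proof.
move=> v_indep; apply/seteqP; split=> p /=.
  by move=> [a [a0 a1 ->]] i; rewrite gerBl bary_unique.
move=> p_le; exists (bary v ^~ p); split.
- by move=> i; have := p_le i; rewrite gerBl.
- exact: sum_bary.
- by rewrite baryK.
Qed.

(* Main.v *)
(* At a point p put d_i = s_i - ell_i(p). As \sum_i d_i = s, the three cases of
   the definition of a placed element merge into one formula: its function is
   \prod_i [d_i >= 0] + (-1)^k \prod_i [d_i < 0].
   By distributivity, the alternating sum over all S of either product is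
   \prod_i (f_i - g_i), with f_i, g_i the factors after and before moving the
   i-th facet. Since [d < 0] = 1 - [d >= 0], the second product is (-1)^(k+1)
   times the first, so the two contributions cancel. *)
Require Import Defs.
From mathcomp Require Import all_boot all_order all_algebra.
From mathcomp Require Import classical_sets reals numfun.
Import Order.TTheory GRing.Theory Num.Theory.
Local Open Scope ring_scope.

Lemma prodr_bool (R : comPzRingType) (I : finType) (b : pred I) :
  \prod_i (b i)%:R = [forall i, b i]%:R :> R.
Proof.
have [/forallP b1 | ] := boolP [forall i, b i].
  by rewrite big1 // => i _; rewrite b1.
rewrite negb_forall => /existsP[i /negbTE bi0].
by rewrite (bigD1 i) //= bi0 mul0r.
Qed.

Lemma indic_forall (T : Type) (R : pzRingType) (I : finType)
    (b : I -> pred T) (x : T) :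
  \1_[set y | forall i, b i y]%classic x = [forall i, b i x]%:R :> R.
Proof.
rewrite indicE; congr (nat_of_bool _)%:R.
by apply/idP/forallP; rewrite inE.
Qed.

(** Expand the product of the [f i + - g i]: [S] is the set of indices where [f i] is chosen, and
    each index outside [S] contributes a factor -1. *)
Lemma alternating_sum_prod (R : comPzRingType) (I : finType) (f g : I -> R) :
  \sum_(S : {set I}) (-1) ^+ (#|I| - #|S|) *
    \prod_i (if i \in S then f i else g i) = \prod_i (f i - g i).
Proof.
rewrite bigA_distr; apply: eq_bigr => S _.
have -> : (#|I| - #|S|)%N = #|[pred i | i \notin S]|.
  by rewrite -(cardC (mem S)) addKn.
rewrite -prodr_const [X in X * _]big_mkcond -big_split /=.
apply: eq_bigr => i _; rewrite inE.
by case: (i \in S); rewrite ?mul1r ?mulN1r.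
Qed.

Lemma placedE (R : realType) (k : nat) (v : 'I_k.+1 -> 'rV[R]_k)
    (s : 'I_k.+1 -> R) (p : 'rV[R]_k) :
  affinely_independent v ->
  placed v s p = \prod_i (ell v i p <= s i)%R%:R
                 + (-1) ^+ k * \prod_i (s i < ell v i p)%R%:R.
Proof.
move=> v_indep; rewrite !prodr_bool.
have sumE : \sum_i s i = \sum_i (s i - ell v i p).
  by rewrite sumrB sum_ell // subr0.
have all_le : [forall i, ell v i p <= s i] -> 0 <= \sum_i s i.
  by move=> /forallP le_s; rewrite sumE sumr_ge0 // => i _; rewrite subr_ge0.
have all_gt : [forall i, s i < ell v i p] -> \sum_i s i < 0.
  move=> /forallP gt_s; rewrite -[ltRHS](sum_ell p v_indep).
  (* Strictness of the summed inequality needs a nonempty index type, witnessed by [ord0]. *)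
  apply: ltr_sum => [|i _]; last exact: gt_s.
  by apply/hasP; exists ord0; rewrite ?mem_index_enum.
rewrite /placed; case: (ltrgtP 0 (\sum_i s i)) => [s_gt0 | s_lt0 | s0].
- have /negbTE -> : ~~ [forall i, s i < ell v i p].
    by apply/negP => /all_gt; rewrite ltNge ltW.
  by rewrite mulr0 addr0 indic_forall.
- have /negbTE -> : ~~ [forall i, ell v i p <= s i].
    by apply/negP => /all_le; rewrite leNgt s_lt0.
  by rewrite add0r indic_forall.
- have /negbTE -> : ~~ [forall i, s i < ell v i p].
    by apply/negP => /all_gt; rewrite -s0 ltxx.
  rewrite mulr0 addr0 indicE; congr (nat_of_bool _)%:R.
  apply/idP/forallP => [|le_s]; rewrite inE /=; first by move=> eq_s i; rewrite eq_s.
  move=> i.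
  (* These nonnegative differences sum to 0, so each vanishes: the closed simplex has shrunk to the
     point. *)
  have d_ge0 j : true -> 0 <= s j - ell v j p by rewrite subr_ge0.
  by apply/esym/subr0_eq/(psumr_eq0P d_ge0); rewrite -?sumE.
Qed.

Lemma alternating_sum_placed (R : realType) (k : nat)
    (v : 'I_k.+1 -> 'rV[R]_k) (t x : 'I_k.+1 -> R) (p : 'rV[R]_k) :
  affinely_independent v ->
  \sum_(S : {set 'I_k.+1})
    (-1) ^+ (k.+1 - #|S|) * placed v (move_facets t x S) p = 0.
Proof.
move=> v_indep; under eq_bigr do rewrite placedE // mulrDr mulrCA.
rewrite big_split -mulr_sumr /=.
(* Stated for any [h] so that it serves both products: the [i]-th factor depends on [S] only through
   whether [i] is in [S]. *)
have altE (h : 'I_k.+1 -> R -> int) :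
    \sum_(S : {set 'I_k.+1}) (-1) ^+ (k.+1 - #|S|) *
      \prod_i h i (move_facets t x S i) =
    \prod_i (h i (t i + x i) - h i (t i)).
  rewrite -alternating_sum_prod card_ord; apply: eq_bigr => S _.
  by congr (_ * _); apply: eq_bigr => i _; rewrite /move_facets; case: ifP.
rewrite (altE (fun i r => (ell v i p <= r)%R%:R)).
rewrite (altE (fun i r => (r < ell v i p)%R%:R)).
have -> : \prod_i ((t i + x i < ell v i p)%R%:R - (t i < ell v i p)%R%:R) =
    \prod_i - ((ell v i p <= t i + x i)%R%:R - (ell v i p <= t i)%R%:R) :> int.
  by apply: eq_bigr => i _; rewrite !ltNge; do 2!case: (_ <= _).
by rewrite prodrN card_ord mulrA exprS mulN1r mulrN -expr2 sqrr_sign mulN1r subrr.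
Qed.

Theorem theorem5p3 (R : realType) (k : nat) (k_ge1 : (1 <= k)%N)
    (v : 'I_k.+1 -> 'rV[R]_k) (v_indep : affinely_independent v)
    (x : 'I_k.+1 -> R) (t : R)
    (t_ : 'I_k.+1 -> R) (sum_t : \sum_i t_ i = t) (p : 'rV[R]_k) :
  placed v (move_facets t_ x [set: 'I_k.+1]) p =
  \sum_(S : {set 'I_k.+1} | S \proper [set: 'I_k.+1])
     (-1) ^+ (k - #|S|) * placed v (move_facets t_ x S) p.
Proof.
have /eqP := alternating_sum_placed _ _ _ t_ x p v_indep.
rewrite (bigD1 [set: 'I_k.+1]) //= cardsT card_ord subnn mul1r.
rewrite addr_eq0 -sumrN => /eqP ->.
apply: eq_big => [S | S]; first by rewrite properT.
(* The bound [#|S| <= k] makes the truncated [k.+1 - #|S|] the successor of [k - #|S|]; the extra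
   sign cancels the one from changing sides. *)
rewrite -properT => /proper_card; rewrite cardsT card_ord ltnS => S_le_k.
by rewrite subSn // exprS mulN1r mulNr opprK.
Qed.
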